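(* Let $(\mathcal C,\otimes,I)$ be a symmetric monoidal category with finite coproducts, and let $\mathsf T=(T,\eta,\mu)$ be a linear exponential monad on $(\mathcal C,\otimes,I)$. For every finite family of objects $(A_i)_i$ of $\mathcal C$, the hypernormalisation maps $\mathcal N\colon T(\sum_i A_i)\to T(\sum_i TA_i)$ satisfy the following. (1) (Left inverse.) $\mu_{\sum_i A_i}\circ T\langle T\iota_i\rangle_i\circ \mathcal N=\mathrm{id}\colon T(\sum_i A_i)\to T(\sum_i A_i)$, where $\langle T\iota_i\rangle_i\colon \sum_i TA_i\to T(\sum_i A_i)$ is the copairing of the maps $T\iota_i$ and $\iota_i\colon A_i\to\sum_i A_i$ are the coproduct coprojections. (2) (Idempotency.) $\mathcal N\circ\mathcal N=T(\sum_i\eta_{TA_i})\circ\mathcal N\colon T(\sum_i A_i)\to T(\sum_i TTA_i)$, where the outer $\mathcal N$ on the left is the hypernormalisation map $T(\sum_i TA_i)\to T(\sum_i TTA_i)$ for the family $(TA_i)_i$. (3) (Naturality.) For all maps $f_i\colon A_i\to B_i$ of $\mathcal C$, one has $T(\sum_i Tf_i)\circ\mathcal N=\mathcal N\circ T(\sum_i f_i)\colon T(\sum_i A_i)\to T(\sum_i TB_i)$; and for all Kleisli maps $f_i\colon A_i\to TB_i$, one has $T(\sum_i\mu_{B_i})\circ T(\sum_i Tf_i)\circ\mathcal N=T(\sum_i\mu_{B_i})\circ\mathcal N\circ T(\sum_i f_i)\colon T(\sum_i A_i)\to T(\sum_i TB_i)$.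
   Context: A symmetric opmonoidal structure on a monad $\mathsf T=(T,\eta,\mu)$ on a symmetric monoidal category $(\mathcal C,\otimes,I)$ consists of a map $\upsilon_I\colon TI\to I$ and natural maps $\upsilon_{XY}\colon T(X\otimes Y)\to TX\otimes TY$ making $T$ a symmetric opmonoidal (colax monoidal) functor and $\eta,\mu$ opmonoidal transformations. It lifts the symmetric monoidal structure of $\mathcal C$ to the category $\mathcal C^{\mathsf T}$ of Eilenberg--Moore algebras: $(X,x)\otimes(Y,y)=(X\otimes Y,(x\otimes y)\circ\upsilon_{XY})$, with unit $(I,\upsilon_I)$ and constraints those of $\mathcal C$. (Such structures correspond bijectively to symmetric monoidal structures on $\mathcal C^{\mathsf T}$ for which the forgetful functor is strict symmetric monoidal.) A linear exponential monad is a symmetric opmonoidal monad for which the lifted structure on $\mathcal C^{\mathsf T}$ is given by finite coproducts: $(I,\upsilon_I)$ is initial in $\mathcal C^{\mathsf T}$, and for all algebras $(X,x),(Y,y)$ the cospan $(X,x)\cong(X,x)\otimes(I,\upsilon_I)\xrightarrow{1\otimes !}(X,x)\otimes(Y,y)\xleftarrow{!\otimes 1}(I,\upsilon_I)\otimes(Y,y)\cong(Y,y)$ is a coproduct in $\mathcal C^{\mathsf T}$, where $!$ denotes the unique maps out of the initial algebra. Given finite coproducts in $\mathcal C$, write $\varphi\colon T(\sum_i A_i)\to\bigotimes_i TA_i$ for the map underlying the canonical $\mathsf T$-algebra isomorphism $F^{\mathsf T}(\sum_i A_i)\cong\bigotimes_i F^{\mathsf T}A_i$ between two coproducts of the free algebras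 $F^{\mathsf T}A_i=(TA_i,\mu_{A_i})$. The $n$-ary hypernormalisation map is the composite in $\mathcal C$ $$\mathcal N\colon T(\textstyle\sum_i A_i)\xrightarrow{\varphi}\bigotimes_i TA_i\xrightarrow{\bigotimes_i\eta_{TA_i}}\bigotimes_i TTA_i\xrightarrow{\varphi^{-1}}T(\sum_i TA_i).$$ *)

(* Defs.v *)
(* Hom-sets carry Leibniz equality; [proof_irrelevance] is used only to compare
   algebra morphisms, which are maps paired with a proof. *)
From Stdlib Require Import ProofIrrelevance.
From Stdlib Require Fin.

Set Implicit Arguments.
Unset Strict Implicit.
Unset Printing Implicit Defensive.

Declare Scope cat_scope.
Open Scope cat_scope.

Record Category := {
  Ob :> Type;
  Hom : Ob -> Ob -> Type;
  id : forall X, Hom X X;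
  comp : forall X Y Z, Hom Y Z -> Hom X Y -> Hom X Z;
  comp_assoc : forall W X Y Z (h : Hom Y Z) (g : Hom X Y) (f : Hom W X),
    comp h (comp g f) = comp (comp h g) f;
  id_l : forall X Y (f : Hom X Y), comp (id Y) f = f;
  id_r : forall X Y (f : Hom X Y), comp f (id X) = f
}.

Arguments Hom {_} _ _.
Arguments id {_} _.
Arguments comp {_ _ _ _} _ _.

Notation "X ~> Y" := (Hom X Y) (at level 90, no associativity) : cat_scope.
Notation "g ∘ f" := (comp g f) (at level 40, left associativity) : cat_scope.

Record Iso (C : Category) (X Y : C) := {
  iso_fwd : X ~> Y;
  iso_bwd : Y ~> X;
  iso_bwd_fwd : iso_bwd ∘ iso_fwd = id X;
  iso_fwd_bwd : iso_fwd ∘ iso_bwd = id Y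
}.

Record Functor (C D : Category) := {
  fobj :> C -> D;
  fmap : forall X Y, (X ~> Y) -> (fobj X ~> fobj Y);
  fmap_id : forall X, fmap (id X) = id (fobj X);
  fmap_comp : forall X Y Z (g : Y ~> Z) (f : X ~> Y),
    fmap (g ∘ f) = fmap g ∘ fmap f
}.

Arguments fmap {_ _} _ {_ _} _.

(* Universal properties carry their mediating maps as data; these are uniquely
   determined. *)

Record IsInitial (C : Category) (O : C) := {
  bang : forall X, O ~> X;
  bang_unique : forall X (f : O ~> X), f = bang X
}.

Record IsBinaryCoproduct (C : Category) (X Y S : C)
    (inl_ : X ~> S) (inr_ : Y ~> S) := {
  bcopair : forall Z, (X ~> Z) -> (Y ~> Z) -> (S ~> Z);
  bcopair_inl : forall Z (f : X ~> Z) (g : Y ~> Z), bcopair f g ∘ inl_ = f;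
  bcopair_inr : forall Z (f : X ~> Z) (g : Y ~> Z), bcopair f g ∘ inr_ = g;
  bcopair_unique : forall Z (f : X ~> Z) (g : Y ~> Z) (h : S ~> Z),
    h ∘ inl_ = f -> h ∘ inr_ = g -> h = bcopair f g
}.

Record IsCoproduct (C : Category) (J : Type) (A : J -> C) (S : C)
    (inj : forall j, A j ~> S) := {
  copair : forall Z, (forall j, A j ~> Z) -> (S ~> Z);
  copair_inj : forall Z (f : forall j, A j ~> Z) j, copair f ∘ inj j = f j;
  copair_unique : forall Z (f : forall j, A j ~> Z) (h : S ~> Z),
    (forall j, h ∘ inj j = f j) -> h = copair f
}.

Lemma coproduct_hom_ext (C : Category) (J : Type) (A : J -> C) (S : C)
    (inj : forall j, A j ~> S) (HS : IsCoproduct inj) (Z : C) (g h : S ~> Z) :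
  (forall j, g ∘ inj j = h ∘ inj j) -> g = h.
Proof.
intros H. rewrite (copair_unique HS H).
symmetry. now apply (copair_unique HS).
Qed.

Program Definition coproduct_iso (C : Category) (J : Type) (A : J -> C)
    (S S' : C) (inj : forall j, A j ~> S) (inj' : forall j, A j ~> S')
    (HS : IsCoproduct inj) (HS' : IsCoproduct inj') : Iso S S' :=
  {| iso_fwd := copair HS inj'; iso_bwd := copair HS' inj |}.
Next Obligation.
apply (coproduct_hom_ext HS). intros j.
now rewrite <- comp_assoc, !copair_inj, id_l.
Qed.
Next Obligation.
apply (coproduct_hom_ext HS'). intros j.
now rewrite <- comp_assoc, !copair_inj, id_l.
Qed.

Record FiniteCoproducts (C : Category) := {
  csum : forall n, (Fin.t n -> C) -> C;
  cinj : forall n (A : Fin.t n -> C) (i : Fin.t n), A i ~> csum A;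
  csum_is_coproduct : forall n (A : Fin.t n -> C), IsCoproduct (cinj A)
}.

Arguments csum {_} _ {_} _.
Arguments cinj {_} _ {_} _ _.
Arguments csum_is_coproduct {_} _ {_} _.

Definition ccopair (C : Category) (K : FiniteCoproducts C) (n : nat)
    (A : Fin.t n -> C) (Z : C) (f : forall i, A i ~> Z) : csum K A ~> Z :=
  copair (csum_is_coproduct K A) f.

Definition csum_map (C : Category) (K : FiniteCoproducts C) (n : nat)
    (A B : Fin.t n -> C) (f : forall i, A i ~> B i) : csum K A ~> csum K B :=
  ccopair K (fun i => cinj K B i ∘ f i).

Arguments ccopair {_} _ {_ _ _} _.
Arguments csum_map {_} _ {_ _ _} _.

Reserved Notation "X ⊗ Y" (at level 35, right associativity).
Reserved Notation "f ⊗₁ g" (at level 35, right associativity).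

Record SymMonCategory := {
  smc_cat :> Category;
  munit : smc_cat;
  tensor : smc_cat -> smc_cat -> smc_cat
    where "X ⊗ Y" := (tensor X Y);
  tmap : forall X X' Y Y' : smc_cat,
    (X ~> X') -> (Y ~> Y') -> (X ⊗ Y ~> X' ⊗ Y')
    where "f ⊗₁ g" := (tmap f g);
  tmap_id : forall X Y : smc_cat, id X ⊗₁ id Y = id (X ⊗ Y);
  tmap_comp : forall (X X' X'' Y Y' Y'' : smc_cat)
    (f' : X' ~> X'') (f : X ~> X') (g' : Y' ~> Y'') (g : Y ~> Y'),
    (f' ∘ f) ⊗₁ (g' ∘ g) = (f' ⊗₁ g') ∘ (f ⊗₁ g);
  assoc : forall X Y Z : smc_cat, Iso ((X ⊗ Y) ⊗ Z) (X ⊗ (Y ⊗ Z));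
  lunit : forall X : smc_cat, Iso (munit ⊗ X) X;
  runit : forall X : smc_cat, Iso (X ⊗ munit) X;
  braid : forall X Y : smc_cat, X ⊗ Y ~> Y ⊗ X;
  assoc_nat : forall (X X' Y Y' Z Z' : smc_cat)
    (f : X ~> X') (g : Y ~> Y') (h : Z ~> Z'),
    iso_fwd (assoc X' Y' Z') ∘ ((f ⊗₁ g) ⊗₁ h)
    = (f ⊗₁ (g ⊗₁ h)) ∘ iso_fwd (assoc X Y Z);
  lunit_nat : forall (X X' : smc_cat) (f : X ~> X'),
    iso_fwd (lunit X') ∘ (id munit ⊗₁ f) = f ∘ iso_fwd (lunit X);
  runit_nat : forall (X X' : smc_cat) (f : X ~> X'),
    iso_fwd (runit X') ∘ (f ⊗₁ id munit) = f ∘ iso_fwd (runit X);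
  braid_nat : forall (X X' Y Y' : smc_cat) (f : X ~> X') (g : Y ~> Y'),
    braid X' Y' ∘ (f ⊗₁ g) = (g ⊗₁ f) ∘ braid X Y;
  pentagon : forall W X Y Z : smc_cat,
    iso_fwd (assoc W X (Y ⊗ Z)) ∘ iso_fwd (assoc (W ⊗ X) Y Z)
    = (id W ⊗₁ iso_fwd (assoc X Y Z)) ∘ iso_fwd (assoc W (X ⊗ Y) Z)
      ∘ (iso_fwd (assoc W X Y) ⊗₁ id Z);
  triangle : forall X Y : smc_cat,
    (id X ⊗₁ iso_fwd (lunit Y)) ∘ iso_fwd (assoc X munit Y)
    = iso_fwd (runit X) ⊗₁ id Y;
  hexagon : forall X Y Z : smc_cat,
    iso_fwd (assoc Y Z X) ∘ braid X (Y ⊗ Z) ∘ iso_fwd (assoc X Y Z)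
    = (id Y ⊗₁ braid X Z) ∘ iso_fwd (assoc Y X Z) ∘ (braid X Y ⊗₁ id Z);
  braid_braid : forall X Y : smc_cat, braid Y X ∘ braid X Y = id (X ⊗ Y)
}.

Arguments munit {_}.
Arguments tensor {_} _ _.
Arguments tmap {_ _ _ _ _} _ _.
Arguments assoc {_} _ _ _.
Arguments lunit {_} _.
Arguments runit {_} _.
Arguments braid {_} _ _.

Notation "X ⊗ Y" := (tensor X Y) : cat_scope.
Notation "f ⊗₁ g" := (tmap f g) : cat_scope.

Fixpoint bigtensor (C : SymMonCategory) (n : nat) : (Fin.t n -> C) -> C :=
  match n with
  | 0 => fun _ => munit
  | S m => fun A => A Fin.F1 ⊗ bigtensor (fun i => A (Fin.FS i))
  end.

Fixpoint bigtmap (C : SymMonCategory) (n : nat) : forall A B : Fin.t n -> C,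
    (forall i, A i ~> B i) -> (bigtensor A ~> bigtensor B) :=
  match n return forall A B : Fin.t n -> C,
    (forall i, A i ~> B i) -> (bigtensor A ~> bigtensor B) with
  | 0 => fun _ _ _ => id munit
  | S m => fun _ _ f => f Fin.F1 ⊗₁ bigtmap (fun i => f (Fin.FS i))
  end.

(* The coprojections are X ≅ X ⊗ I -> X ⊗ Y and Y ≅ I ⊗ Y -> X ⊗ Y, so being
   given by finite coproducts is a condition on the structure already there. *)
Record IsCocartesian (M : SymMonCategory) := {
  unit_initial : IsInitial (munit (s := M));
  tensor_coproduct : forall X Y : M,
    IsBinaryCoproduct
      ((id X ⊗₁ bang unit_initial Y) ∘ iso_bwd (runit X))
      ((bang unit_initial X ⊗₁ id Y) ∘ iso_bwd (lunit Y))
}.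

Record Monad (C : Category) := {
  mfun :> Functor C C;
  eta : forall X : C, X ~> mfun X;
  mu : forall X : C, mfun (mfun X) ~> mfun X;
  eta_nat : forall (X Y : C) (f : X ~> Y), eta Y ∘ f = fmap mfun f ∘ eta X;
  mu_nat : forall (X Y : C) (f : X ~> Y),
    mu Y ∘ fmap mfun (fmap mfun f) = fmap mfun f ∘ mu X;
  mu_eta : forall X : C, mu X ∘ eta (mfun X) = id (mfun X);
  mu_fmap_eta : forall X : C, mu X ∘ fmap mfun (eta X) = id (mfun X);
  mu_mu : forall X : C, mu X ∘ mu (mfun X) = mu X ∘ fmap mfun (mu X)
}.

Arguments eta {_} _ _.
Arguments mu {_} _ _.

Record SymOpmonoidal (C : SymMonCategory) (T : Monad C) := {
  ups0 : T munit ~> munit;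
  ups : forall X Y : C, T (X ⊗ Y) ~> T X ⊗ T Y;
  ups_nat : forall (X X' Y Y' : C) (f : X ~> X') (g : Y ~> Y'),
    ups X' Y' ∘ fmap T (f ⊗₁ g) = (fmap T f ⊗₁ fmap T g) ∘ ups X Y;
  ups_assoc : forall X Y Z : C,
    iso_fwd (assoc (T X) (T Y) (T Z)) ∘ (ups X Y ⊗₁ id (T Z)) ∘ ups (X ⊗ Y) Z
    = (id (T X) ⊗₁ ups Y Z) ∘ ups X (Y ⊗ Z) ∘ fmap T (iso_fwd (assoc X Y Z));
  ups_lunit : forall X : C,
    iso_fwd (lunit (T X)) ∘ (ups0 ⊗₁ id (T X)) ∘ ups munit X
    = fmap T (iso_fwd (lunit X));
  ups_runit : forall X : C,
    iso_fwd (runit (T X)) ∘ (id (T X) ⊗₁ ups0) ∘ ups X munit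
    = fmap T (iso_fwd (runit X));
  ups_braid : forall X Y : C,
    braid (T X) (T Y) ∘ ups X Y = ups Y X ∘ fmap T (braid X Y);
  ups0_eta : ups0 ∘ eta T munit = id munit;
  ups_eta : forall X Y : C, ups X Y ∘ eta T (X ⊗ Y) = eta T X ⊗₁ eta T Y;
  ups0_mu : ups0 ∘ mu T munit = ups0 ∘ fmap T ups0;
  ups_mu : forall X Y : C,
    ups X Y ∘ mu T (X ⊗ Y)
    = (mu T X ⊗₁ mu T Y) ∘ ups (T X) (T Y) ∘ fmap T (ups X Y)
}.

Arguments ups0 {_ _} _.
Arguments ups {_ _} _ _ _.

Section EilenbergMoore.

Context (C : Category) (T : Monad C).

Record Alg := {
  carrier : C;
  action : T carrier ~> carrier;
  action_eta : action ∘ eta T carrier = id carrier;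
  action_mu : action ∘ mu T carrier = action ∘ fmap T action
}.

Definition is_alg_map (X Y : Alg) (f : carrier X ~> carrier Y) : Prop :=
  f ∘ action X = action Y ∘ fmap T f.

Definition AlgHom (X Y : Alg) : Type :=
  { f : carrier X ~> carrier Y | is_alg_map f }.

Lemma AlgHom_eq (X Y : Alg) (f g : AlgHom X Y) : proj1_sig f = proj1_sig g -> f = g.
Proof.
destruct f as [f Hf], g as [g Hg]; simpl. intros E. subst g.
f_equal. apply proof_irrelevance.
Qed.

Lemma is_alg_map_id (X : Alg) : is_alg_map (id (carrier X) : carrier X ~> carrier X).
Proof. unfold is_alg_map. now rewrite fmap_id, id_l, id_r. Qed.

Lemma is_alg_map_comp (X Y Z : Alg) (g : carrier Y ~> carrier Z)
    (f : carrier X ~> carrier Y) :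
  is_alg_map g -> is_alg_map f -> is_alg_map (X := X) (Y := Z) (g ∘ f).
Proof.
unfold is_alg_map. intros Hg Hf.
now rewrite fmap_comp, <- comp_assoc, Hf, comp_assoc, Hg, comp_assoc.
Qed.

Program Definition EM : Category := {|
  Ob := Alg;
  Hom := AlgHom;
  id := fun X => exist _ (id (carrier X)) (is_alg_map_id X);
  comp := fun X Y Z g f => exist _ (proj1_sig g ∘ proj1_sig f)
    (is_alg_map_comp (proj2_sig g) (proj2_sig f))
|}.
Next Obligation. apply AlgHom_eq; simpl. apply comp_assoc. Qed.
Next Obligation. apply AlgHom_eq; simpl. apply id_l. Qed.
Next Obligation. apply AlgHom_eq; simpl. apply id_r. Qed.

Lemma is_alg_map_inverse (X Y : Alg) (f : Iso (carrier X) (carrier Y)) :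
  is_alg_map (X := X) (Y := Y) (iso_fwd f) ->
  is_alg_map (X := Y) (Y := X) (iso_bwd f).
Proof.
unfold is_alg_map. intros H.
rewrite <- (id_r (iso_bwd f ∘ action Y)), <- fmap_id, <- (iso_fwd_bwd f).
rewrite fmap_comp, comp_assoc, <- (comp_assoc _ (action Y)), <- H.
now rewrite (comp_assoc (iso_bwd f)), iso_bwd_fwd, id_l.
Qed.

Program Definition alg_iso (X Y : EM) (f : Iso (carrier X) (carrier Y))
    (Hf : is_alg_map (X := X) (Y := Y) (iso_fwd f)) : Iso X Y := {|
  iso_fwd := exist _ (iso_fwd f) Hf;
  iso_bwd := exist _ (iso_bwd f) (is_alg_map_inverse Hf)
|}.
Next Obligation. apply AlgHom_eq; simpl. apply iso_bwd_fwd. Qed.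
Next Obligation. apply AlgHom_eq; simpl. apply iso_fwd_bwd. Qed.

Definition free_alg (A : C) : EM :=
  {| carrier := T A; action := mu T A;
     action_eta := mu_eta T A; action_mu := mu_mu T A |}.

Program Definition free : Functor C EM := {|
  fobj := free_alg;
  fmap := fun A B f => exist _ (fmap T f) (eq_sym (mu_nat T f))
|}.
Next Obligation. apply AlgHom_eq; simpl. apply fmap_id. Qed.
Next Obligation. apply AlgHom_eq; simpl. apply fmap_comp. Qed.

Program Definition free_extend (A : C) (Z : EM) (g : A ~> carrier Z) :
    free A ~> Z := exist _ (action Z ∘ fmap T g) _.
Next Obligation.
unfold is_alg_map; simpl.
rewrite <- comp_assoc, <- (mu_nat T g), comp_assoc, action_mu.
now rewrite !fmap_comp, !comp_assoc.
Qed.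

Program Definition free_preserves_coproduct (J : Type) (A : J -> C) (S : C)
    (inj : forall j, A j ~> S) (HS : IsCoproduct inj) :
    IsCoproduct (C := EM) (A := fun j => free (A j)) (fun j => fmap free (inj j)) := {|
  copair := fun Z f =>
    free_extend (copair HS (fun j => proj1_sig (f j) ∘ eta T (A j)))
|}.
Next Obligation.
apply AlgHom_eq; simpl. destruct (f j) as [g Hg] eqn:E; unfold is_alg_map in Hg; simpl in *.
rewrite <- comp_assoc, <- fmap_comp, copair_inj, E; simpl.
now rewrite fmap_comp, comp_assoc, <- Hg, <- comp_assoc, mu_fmap_eta, id_r.
Qed.
Next Obligation.
apply AlgHom_eq; simpl.
rewrite <- (copair_unique HS (h := proj1_sig h ∘ eta T S)).
- destruct h as [h Hh]; unfold is_alg_map in Hh; simpl in *.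
  now rewrite fmap_comp, comp_assoc, <- Hh, <- comp_assoc, mu_fmap_eta, id_r.
- intros j. rewrite <- H; simpl. now rewrite <- !comp_assoc, eta_nat.
Qed.

End EilenbergMoore.

Arguments carrier {_ _} _.
Arguments action {_ _} _.
Arguments EM {_} _.
Arguments free {_} _.

Section Lifting.

Context (C : SymMonCategory) (T : Monad C) (U : SymOpmonoidal T).

Lemma tmap_comp_l (X X' X'' Y Y' : C) (f' : X' ~> X'') (f : X ~> X') (g : Y ~> Y') :
  (f' ∘ f) ⊗₁ g = (f' ⊗₁ id Y') ∘ (f ⊗₁ g).
Proof. now rewrite <- tmap_comp, id_l. Qed.

Lemma tmap_comp_r (X X' Y Y' Y'' : C) (f : X ~> X') (g' : Y' ~> Y'') (g : Y ~> Y') :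
  f ⊗₁ (g' ∘ g) = (id X' ⊗₁ g') ∘ (f ⊗₁ g).
Proof. now rewrite <- tmap_comp, id_l. Qed.

Definition unit_alg : EM T :=
  {| carrier := munit; action := ups0 U;
     action_eta := ups0_eta U; action_mu := ups0_mu U |}.

Program Definition tensor_alg (X Y : EM T) : EM T := {|
  carrier := carrier X ⊗ carrier Y;
  action := (action X ⊗₁ action Y) ∘ ups U (carrier X) (carrier Y)
|}.
Next Obligation.
now rewrite <- comp_assoc, ups_eta, <- tmap_comp, !action_eta, tmap_id.
Qed.
Next Obligation.
rewrite <- comp_assoc, ups_mu, !comp_assoc, <- tmap_comp, !action_mu.
rewrite fmap_comp, !comp_assoc. f_equal.
now rewrite <- (comp_assoc _ (ups U _ _)), ups_nat, comp_assoc, <- tmap_comp.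
Qed.

Program Definition tmap_alg (X X' Y Y' : EM T) (f : X ~> X') (g : Y ~> Y') :
    tensor_alg X Y ~> tensor_alg X' Y' :=
  exist _ (proj1_sig f ⊗₁ proj1_sig g) _.
Next Obligation.
unfold is_alg_map; simpl.
destruct f as [f Hf], g as [g Hg]; unfold is_alg_map in *; simpl in *.
rewrite <- (comp_assoc _ (ups U _ _)), ups_nat, !comp_assoc.
now rewrite <- !tmap_comp, Hf, Hg.
Qed.

Lemma assoc_is_alg_map (X Y Z : EM T) :
  is_alg_map (X := tensor_alg (tensor_alg X Y) Z)
    (Y := tensor_alg X (tensor_alg Y Z))
    (iso_fwd (assoc (carrier X) (carrier Y) (carrier Z))).
Proof.
unfold is_alg_map; simpl.
rewrite <- (id_r (action Z)) at 1. rewrite tmap_comp.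
rewrite !comp_assoc, assoc_nat.
rewrite <- !comp_assoc, (comp_assoc (iso_fwd _)), ups_assoc, !comp_assoc.
now rewrite <- tmap_comp, id_r.
Qed.

Lemma lunit_is_alg_map (X : EM T) :
  is_alg_map (X := tensor_alg unit_alg X) (Y := X) (iso_fwd (lunit (carrier X))).
Proof.
unfold is_alg_map; simpl.
rewrite <- ups_lunit with (s := U), !comp_assoc, <- lunit_nat.
now rewrite <- (comp_assoc _ (id _ ⊗₁ _)), <- tmap_comp, id_l, id_r.
Qed.

Lemma runit_is_alg_map (X : EM T) :
  is_alg_map (X := tensor_alg X unit_alg) (Y := X) (iso_fwd (runit (carrier X))).
Proof.
unfold is_alg_map; simpl.
rewrite <- ups_runit with (s := U), !comp_assoc, <- runit_nat.
now rewrite <- (comp_assoc _ (_ ⊗₁ id munit)), <- tmap_comp, id_l, id_r.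
Qed.

Lemma braid_is_alg_map (X Y : EM T) :
  is_alg_map (X := tensor_alg X Y) (Y := tensor_alg Y X)
    (braid (carrier X) (carrier Y)).
Proof.
unfold is_alg_map; simpl.
now rewrite comp_assoc, braid_nat, <- !comp_assoc, ups_braid.
Qed.

Program Definition EM_smc : SymMonCategory := {|
  smc_cat := EM T;
  munit := unit_alg;
  tensor := tensor_alg;
  tmap := tmap_alg;
  assoc := fun X Y Z => alg_iso (assoc_is_alg_map X Y Z);
  lunit := fun X => alg_iso (lunit_is_alg_map X);
  runit := fun X => alg_iso (runit_is_alg_map X);
  braid := fun X Y => exist _ (braid (carrier X) (carrier Y)) (braid_is_alg_map X Y)
|}.
Next Obligation. apply AlgHom_eq; simpl. apply tmap_id. Qed.
Next Obligation. apply AlgHom_eq; simpl. apply tmap_comp. Qed.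
Next Obligation. apply AlgHom_eq; simpl. apply assoc_nat. Qed.
Next Obligation. apply AlgHom_eq; simpl. apply lunit_nat. Qed.
Next Obligation. apply AlgHom_eq; simpl. apply runit_nat. Qed.
Next Obligation. apply AlgHom_eq; simpl. apply braid_nat. Qed.
Next Obligation. apply AlgHom_eq; simpl. apply pentagon. Qed.
Next Obligation. apply AlgHom_eq; simpl. apply triangle. Qed.
Next Obligation. apply AlgHom_eq; simpl. apply hexagon. Qed.
Next Obligation. apply AlgHom_eq; simpl. apply braid_braid. Qed.

Definition LinearExponential : Type := IsCocartesian EM_smc.

(* The iterated tensor of algebras.  It is spelled out on the iterated tensor
   of the carriers, rather than taken to be [bigtensor] in [EM_smc], so that its
   carrier is definitionally [bigtensor] of the carriers for every [n]. *)
Fixpoint bigtensor_action (n : nat) : forall X : Fin.t n -> EM T,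
    T (bigtensor (fun i => carrier (X i))) ~> bigtensor (fun i => carrier (X i)) :=
  match n return forall X : Fin.t n -> EM T,
    T (bigtensor (fun i => carrier (X i))) ~> bigtensor (fun i => carrier (X i)) with
  | 0 => fun _ => ups0 U
  | S m => fun X =>
      (action (X Fin.F1) ⊗₁ bigtensor_action (fun i => X (Fin.FS i))) ∘ ups U _ _
  end.

Lemma bigtensor_action_laws (n : nat) (X : Fin.t n -> EM T) :
  bigtensor_action X ∘ eta T _ = id _ /\
  bigtensor_action X ∘ mu T _ = bigtensor_action X ∘ fmap T (bigtensor_action X).
Proof.
induction n as [|n IH].
- exact (conj (ups0_eta U) (ups0_mu U)).
- destruct (IH (fun i => X (Fin.FS i))) as [H1 H2].
  pose (Y := tensor_alg (X Fin.F1) (Build_Alg H1 H2)).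
  exact (conj (action_eta Y) (action_mu Y)).
Qed.

Definition bigtensor_alg (n : nat) (X : Fin.t n -> EM T) : EM T :=
  Build_Alg (proj1 (bigtensor_action_laws X)) (proj2 (bigtensor_action_laws X)).

Context (L : LinearExponential).

Definition tensor_inl (X Y : EM_smc) : X ~> X ⊗ Y :=
  (id X ⊗₁ bang (unit_initial L) Y) ∘ iso_bwd (runit X).

Definition tensor_inr (X Y : EM_smc) : Y ~> X ⊗ Y :=
  (bang (unit_initial L) X ⊗₁ id Y) ∘ iso_bwd (lunit Y).

(* For [S m], algebra maps into or out of [bigtensor_alg X] are convertible
   with those of [tensor_alg (X F1) (bigtensor_alg (X o FS))]. *)
Fixpoint bigtensor_inj (n : nat) : forall (X : Fin.t n -> EM T) (i : Fin.t n),
    X i ~> bigtensor_alg X :=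
  match n return forall (X : Fin.t n -> EM T) (i : Fin.t n),
    X i ~> bigtensor_alg X with
  | 0 => fun X i => Fin.case0 (fun i => X i ~> bigtensor_alg X) i
  | S m => fun X i =>
      let Y := bigtensor_alg (fun j => X (Fin.FS j)) in
      Fin.caseS' i (fun i => X i ~> bigtensor_alg X)
        (tensor_inl (X Fin.F1) Y)
        (fun j => (tensor_inr (X Fin.F1) Y : Y ~> tensor_alg (X Fin.F1) Y)
                  ∘ bigtensor_inj (fun j => X (Fin.FS j)) j)
  end.

Fixpoint bigtensor_copair (n : nat) : forall (X : Fin.t n -> EM T) (Z : EM T),
    (forall i, X i ~> Z) -> (bigtensor_alg X ~> Z) :=
  match n return forall (X : Fin.t n -> EM T) (Z : EM T),
    (forall i, X i ~> Z) -> (bigtensor_alg X ~> Z) with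
  | 0 => fun X Z _ => bang (unit_initial L) Z
  | S m => fun X Z f =>
      bcopair (tensor_coproduct L (X Fin.F1) (bigtensor_alg (fun j => X (Fin.FS j))))
        (f Fin.F1) (bigtensor_copair (fun j => f (Fin.FS j)))
  end.

Lemma bigtensor_copair_inj (n : nat) (X : Fin.t n -> EM T) (Z : EM T)
    (f : forall i, X i ~> Z) (i : Fin.t n) :
  bigtensor_copair f ∘ bigtensor_inj X i = f i.
Proof.
induction n as [|n IH]; [inversion i|].
apply (Fin.caseS' i).
- apply AlgHom_eq.
  exact (f_equal (@proj1_sig _ _) (bcopair_inl (tensor_coproduct L (X Fin.F1)
    (bigtensor_alg (fun j => X (Fin.FS j)))) (f Fin.F1)
    (bigtensor_copair (fun j => f (Fin.FS j))))).
- intros j. rewrite <- (IH _ (fun j => f (Fin.FS j)) j).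
  pose proof (f_equal (@proj1_sig _ _) (bcopair_inr (tensor_coproduct L (X Fin.F1)
    (bigtensor_alg (fun j => X (Fin.FS j)))) (f Fin.F1)
    (bigtensor_copair (fun j => f (Fin.FS j))))) as H.
  apply AlgHom_eq. cbn in H |- *. rewrite <- H. apply comp_assoc.
Qed.

Lemma bigtensor_copair_unique (n : nat) (X : Fin.t n -> EM T) (Z : EM T)
    (f : forall i, X i ~> Z) (h : bigtensor_alg X ~> Z) :
  (forall i, h ∘ bigtensor_inj X i = f i) -> h = bigtensor_copair f.
Proof.
induction n as [|n IH]; intros H.
- apply (bang_unique (unit_initial L) (X := Z) h).
- set (Y := bigtensor_alg (fun j => X (Fin.FS j))).
  apply (bcopair_unique (tensor_coproduct L (X Fin.F1) Y) (h := h)).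
  + rewrite <- (H Fin.F1). apply AlgHom_eq. reflexivity.
  + apply IH. intros j. rewrite <- (H (Fin.FS j)). apply AlgHom_eq; cbn.
    symmetry. apply comp_assoc.
Qed.

Definition bigtensor_is_coproduct (n : nat) (X : Fin.t n -> EM T) :
    IsCoproduct (bigtensor_inj X) :=
  {| copair := @bigtensor_copair n X;
     copair_inj := @bigtensor_copair_inj n X;
     copair_unique := @bigtensor_copair_unique n X |}.

Context (K : FiniteCoproducts C).

Definition phi_iso (n : nat) (A : Fin.t n -> C) :
    Iso (free T (csum K A)) (bigtensor_alg (fun i => free T (A i))) :=
  coproduct_iso (free_preserves_coproduct T (csum_is_coproduct K A))
    (bigtensor_is_coproduct (fun i => free T (A i))).

Definition phi (n : nat) (A : Fin.t n -> C) :
    T (csum K A) ~> bigtensor (fun i => T (A i)) :=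
  proj1_sig (iso_fwd (phi_iso A)).

Definition phi_inv (n : nat) (A : Fin.t n -> C) :
    bigtensor (fun i => T (A i)) ~> T (csum K A) :=
  proj1_sig (iso_bwd (phi_iso A)).

Definition hypernorm (n : nat) (A : Fin.t n -> C) :
    T (csum K A) ~> T (csum K (fun i => T (A i))) :=
  phi_inv (fun i => T (A i)) ∘ bigtmap (fun i => eta T (T (A i))) ∘ phi A.

End Lifting.

Arguments hypernorm {_ _ _} _ _ {_} _.

(* Main.v *)
(* The map phi identifies T(sum A_i) with the tensor of the free algebras T A_i,
   and under it any algebra map F(sum A_i) -> F(sum B_i) that restricts to h_i
   on the i-th summand becomes the tensor of the h_i, because both sides are algebra
   maps out of a coproduct.  Conjugating by phi, hypernormalisation is the tensor
   of the maps eta_{T A_i}, so (1) becomes mu o eta = id, (2) becomes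
   eta o eta = T eta o eta, and (3) becomes the naturality of eta.  The Kleisli
   form of (3) is its plain form at the maps A_i -> T B_i, followed by
   T(sum mu). *)
Require Import Defs.
From Stdlib Require Fin.

Set Implicit Arguments.
Unset Strict Implicit.
Unset Printing Implicit Defensive.

(** Induction on [n] compares one tensor factor at a time, so families of maps can be exchanged
    without functional extensionality. *)
Lemma bigtmap_ext (C : SymMonCategory) (n : nat) (A B : Fin.t n -> C)
    (f g : forall i, A i ~> B i) :
  (forall i, f i = g i) -> bigtmap f = bigtmap g.
Proof.
induction n as [|n IH]; intros H; cbn; [reflexivity|].
now rewrite H, (IH _ _ _ (fun i => g (Fin.FS i)) (fun i => H (Fin.FS i))).
Qed.

Lemma bigtmap_id (C : SymMonCategory) (n : nat) (A : Fin.t n -> C) :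
  bigtmap (fun i => id (A i)) = id (bigtensor A).
Proof.
induction n as [|n IH]; cbn; [reflexivity|].
rewrite (IH (fun i => A (Fin.FS i))). apply tmap_id.
Qed.

Lemma bigtmap_comp (C : SymMonCategory) (n : nat) (A B D : Fin.t n -> C)
    (g : forall i, B i ~> D i) (f : forall i, A i ~> B i) :
  bigtmap (fun i => g i ∘ f i) = bigtmap g ∘ bigtmap f.
Proof.
induction n as [|n IH]; cbn; [symmetry; apply id_l|].
rewrite (IH _ _ _ (fun i => g (Fin.FS i)) (fun i => f (Fin.FS i))).
apply tmap_comp.
Qed.

(** Transfers the naturality of the unitors to their inverses, which are what the coprojections into
    a tensor contain. *)
Lemma iso_bwd_natural (C : Category) (X X' Y Y' : C) (p : Iso X X') (q : Iso Y Y')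
    (f : X ~> Y) (f' : X' ~> Y') :
  iso_fwd q ∘ f = f' ∘ iso_fwd p -> iso_bwd q ∘ f' = f ∘ iso_bwd p.
Proof.
intros H.
rewrite <- (id_r (_ ∘ f')), <- (iso_fwd_bwd p), comp_assoc, <- (comp_assoc _ f').
now rewrite <- H, comp_assoc, iso_bwd_fwd, id_l.
Qed.

(** Both sides reduce to [f] tensored with a map out of the unit, after the inverse unitor; the two
    maps out of the unit agree by initiality. *)
Lemma cocartesian_inl_natural (M : SymMonCategory) (L : IsCocartesian M)
    (X X' Y Y' : M) (f : X ~> X') (g : Y ~> Y') :
  (f ⊗₁ g) ∘ ((id X ⊗₁ bang (unit_initial L) Y) ∘ iso_bwd (runit X))
  = (id X' ⊗₁ bang (unit_initial L) Y') ∘ iso_bwd (runit X') ∘ f.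
Proof.
rewrite <- (comp_assoc _ (iso_bwd _) f), (iso_bwd_natural (runit_nat f)), !comp_assoc.
rewrite <- !tmap_comp, id_l, !id_r.
now rewrite (bang_unique (unit_initial L) (g ∘ _)).
Qed.

Lemma cocartesian_inr_natural (M : SymMonCategory) (L : IsCocartesian M)
    (X X' Y Y' : M) (f : X ~> X') (g : Y ~> Y') :
  (f ⊗₁ g) ∘ ((bang (unit_initial L) X ⊗₁ id Y) ∘ iso_bwd (lunit Y))
  = (bang (unit_initial L) X' ⊗₁ id Y') ∘ iso_bwd (lunit Y') ∘ g.
Proof.
rewrite <- (comp_assoc _ (iso_bwd _) g), (iso_bwd_natural (lunit_nat g)), !comp_assoc.
rewrite <- !tmap_comp, id_l, !id_r.
now rewrite (bang_unique (unit_initial L) (f ∘ _)).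
Qed.

Section LinearExponential.

Context (C : SymMonCategory) (T : Monad C) (U : SymOpmonoidal T).
Context (L : LinearExponential U).

Lemma bigtmap_is_alg_map (n : nat) (X Y : Fin.t n -> EM T) (f : forall i, X i ~> Y i) :
  is_alg_map (X := bigtensor_alg U X) (Y := bigtensor_alg U Y)
    (bigtmap (fun i => proj1_sig (f i))).
Proof.
induction n as [|n IH].
- unfold is_alg_map; cbn. now rewrite fmap_id, id_l, id_r.
(* The action on a nonempty iterated tensor unfolds to that of [tensor_alg] on head and tail, so the
   binary case applies, with the tail map supplied by induction. *)
- exact (proj2_sig (tmap_alg U (f Fin.F1)
    (exist _ _ (IH _ _ (fun i => f (Fin.FS i)))
      : bigtensor_alg U (fun i => X (Fin.FS i))
        ~> bigtensor_alg U (fun i => Y (Fin.FS i))))).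
Qed.

Definition bigtmap_alg (n : nat) (X Y : Fin.t n -> EM T) (f : forall i, X i ~> Y i) :
    bigtensor_alg U X ~> bigtensor_alg U Y :=
  exist _ _ (bigtmap_is_alg_map f).

Lemma bigtensor_inj_natural (n : nat) (X Y : Fin.t n -> EM T)
    (f : forall i, X i ~> Y i) (i : Fin.t n) :
  bigtmap_alg f ∘ bigtensor_inj L X i = bigtensor_inj L Y i ∘ f i.
Proof.
induction n as [|n IH]; [inversion i|].
set (g := bigtmap_alg (fun i => f (Fin.FS i))).
apply (Fin.caseS' i).
(* The iterated tensor algebra and the binary one share carrier and action but carry different
   proofs of the laws, so equations pass between them through the underlying maps. *)
- apply AlgHom_eq.
  exact (f_equal (@proj1_sig _ _) (cocartesian_inl_natural (M := EM_smc U) L (f Fin.F1) g)).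
- intros j.
  pose proof (f_equal (@proj1_sig _ _) (cocartesian_inr_natural (M := EM_smc U) L (f Fin.F1) g)) as Hr.
  pose proof (f_equal (@proj1_sig _ _) (IH _ _ (fun i => f (Fin.FS i)) j)) as Hj.
  apply AlgHom_eq. cbn in Hr, Hj |- *.
  now rewrite comp_assoc, Hr, <- !comp_assoc, <- Hj.
Qed.

Context (K : FiniteCoproducts C).

Lemma phi_inv_phi (n : nat) (A : Fin.t n -> C) :
  phi_inv L K A ∘ phi L K A = id (T (csum K A)).
Proof. exact (f_equal (@proj1_sig _ _) (iso_bwd_fwd (phi_iso L K A))). Qed.

Lemma phi_phi_inv (n : nat) (A : Fin.t n -> C) :
  phi L K A ∘ phi_inv L K A = id (bigtensor (fun i => T (A i))).
Proof. exact (f_equal (@proj1_sig _ _) (iso_fwd_bwd (phi_iso L K A))). Qed.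

(** Allowing an arbitrary algebra map [H], not just [T] of a map, covers multiplication as well as
    functoriality. *)
Lemma phi_natural (n : nat) (A B : Fin.t n -> C)
    (h : forall i, free T (A i) ~> free T (B i))
    (H : free T (csum K A) ~> free T (csum K B)) :
  (forall i, H ∘ fmap (free T) (cinj K A i) = fmap (free T) (cinj K B i) ∘ h i) ->
  phi L K B ∘ proj1_sig H = bigtmap (fun i => proj1_sig (h i)) ∘ phi L K A.
Proof.
intros Hh.
(* The equation is lifted from [C] to algebras, where the source of [phi] is a coproduct and it
   suffices to test on coprojections. *)
apply (f_equal (@proj1_sig _ _)
  (x := iso_fwd (phi_iso L K B) ∘ H)
  (y := bigtmap_alg h ∘ iso_fwd (phi_iso L K A))).
apply (coproduct_hom_ext (free_preserves_coproduct T (csum_is_coproduct K A))).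
intros i. rewrite <- comp_assoc, Hh, <- comp_assoc. unfold phi_iso, coproduct_iso.
cbn [iso_fwd].
rewrite comp_assoc.
(* Each comparison isomorphism sends the free image of a coprojection to the matching coprojection
   into the tensor. *)
rewrite (copair_inj (free_preserves_coproduct T (csum_is_coproduct K B))
  (bigtensor_inj L (fun i => free T (B i))) i).
rewrite (copair_inj (free_preserves_coproduct T (csum_is_coproduct K A))
  (bigtensor_inj L (fun i => free T (A i))) i).
exact (eq_sym (bigtensor_inj_natural h i)).
Qed.

Lemma phi_fmap (n : nat) (A B : Fin.t n -> C) (f : forall i, A i ~> B i) :
  phi L K B ∘ fmap T (csum_map K f) = bigtmap (fun i => fmap T (f i)) ∘ phi L K A.
Proof.
apply (phi_natural (h := fun i => fmap (free T) (f i))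
  (H := fmap (free T) (csum_map K f))).
intros i. rewrite <- !fmap_comp. f_equal.
apply (copair_inj (csum_is_coproduct K A)).
Qed.

Lemma mu_is_alg_map (X : C) :
  is_alg_map (X := free T (T X)) (Y := free T X) (mu T X).
Proof. apply mu_mu. Qed.

(** The map after [phi] is the algebra map extending the copairing of the [T] of coprojections;
    naturality of [mu] identifies its restriction to each summand. *)
Lemma phi_mu (n : nat) (A : Fin.t n -> C) :
  phi L K A ∘ (mu T (csum K A) ∘ fmap T (ccopair K (fun i => fmap T (cinj K A i))))
  = bigtmap (fun i => mu T (A i)) ∘ phi L K (fun i => T (A i)).
Proof.
apply (phi_natural (A := fun i => T (A i))
  (h := fun i => exist _ _ (mu_is_alg_map (A i)))
  (H := free_extend (Z := free T (csum K A))
          (ccopair K (fun i => fmap T (cinj K A i))))).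
intros i. apply AlgHom_eq; cbn.
rewrite <- comp_assoc, <- fmap_comp. unfold ccopair.
rewrite (copair_inj (csum_is_coproduct K (fun i => T (A i)))
  (fun i => fmap T (cinj K A i)) i).
apply mu_nat.
Qed.

Lemma phi_hypernorm (n : nat) (A : Fin.t n -> C) :
  phi L K (fun i => T (A i)) ∘ hypernorm L K A
  = bigtmap (fun i => eta T (T (A i))) ∘ phi L K A.
Proof. unfold hypernorm. now rewrite !comp_assoc, phi_phi_inv, id_l. Qed.

(** Lets each law be checked after composing with [phi], where it becomes an identity between
    tensors of maps. *)
Lemma phi_mono (n : nat) (A : Fin.t n -> C) (X : C) (f g : X ~> T (csum K A)) :
  phi L K A ∘ f = phi L K A ∘ g -> f = g.
Proof.
intros H.
now rewrite <- (id_l f), <- (id_l g), <- phi_inv_phi, <- !comp_assoc, H.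
Qed.

Lemma hypernorm_left_inverse (n : nat) (A : Fin.t n -> C) :
  mu T (csum K A) ∘ fmap T (ccopair K (fun i => fmap T (cinj K A i)))
    ∘ hypernorm L K A
  = id (T (csum K A)).
Proof.
apply phi_mono.
rewrite comp_assoc, phi_mu, <- comp_assoc, phi_hypernorm, comp_assoc, id_r.
rewrite <- bigtmap_comp, (bigtmap_ext (g := fun i => id (T (A i)))).
- now rewrite bigtmap_id, id_l.
- intros i. apply mu_eta.
Qed.

Lemma hypernorm_idempotent (n : nat) (A : Fin.t n -> C) :
  hypernorm L K (fun i => T (A i)) ∘ hypernorm L K A
  = fmap T (csum_map K (fun i => eta T (T (A i)))) ∘ hypernorm L K A.
Proof.
apply phi_mono.
rewrite !comp_assoc, phi_fmap, (phi_hypernorm (fun i => T (A i))), <- !comp_assoc.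
rewrite phi_hypernorm, !comp_assoc. f_equal.
(* What remains in each factor is the naturality of [eta] at the map [eta T (T (A i))] itself. *)
rewrite <- !bigtmap_comp. apply bigtmap_ext. intros i. apply eta_nat.
Qed.

Lemma hypernorm_natural (n : nat) (A B : Fin.t n -> C) (f : forall i, A i ~> B i) :
  fmap T (csum_map K (fun i => fmap T (f i))) ∘ hypernorm L K A
  = hypernorm L K B ∘ fmap T (csum_map K f).
Proof.
apply phi_mono.
rewrite !comp_assoc, phi_fmap, phi_hypernorm, <- !comp_assoc.
rewrite phi_hypernorm, phi_fmap, !comp_assoc. f_equal.
(* Here the naturality of [eta] is used at [fmap T (f i)]. *)
rewrite <- !bigtmap_comp. apply bigtmap_ext. intros i. symmetry. apply eta_nat.
Qed.

End LinearExponential.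

Theorem proposition15
  (C : SymMonCategory) (K : FiniteCoproducts C)
  (T : Monad C) (U : SymOpmonoidal T) (L : LinearExponential U)
  (n : nat) (A : Fin.t n -> C) :
  (mu T (csum K A) ∘ fmap T (ccopair K (fun i => fmap T (cinj K A i)))
     ∘ hypernorm L K A
   = id (T (csum K A)))
  /\
  (hypernorm L K (fun i => T (A i)) ∘ hypernorm L K A
   = fmap T (csum_map K (fun i => eta T (T (A i)))) ∘ hypernorm L K A)
  /\
  (forall (B : Fin.t n -> C) (f : forall i, A i ~> B i),
     fmap T (csum_map K (fun i => fmap T (f i))) ∘ hypernorm L K A
     = hypernorm L K B ∘ fmap T (csum_map K f))
  /\
  (forall (B : Fin.t n -> C) (f : forall i, A i ~> T (B i)),
     fmap T (csum_map K (fun i => mu T (B i)))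
       ∘ fmap T (csum_map K (fun i => fmap T (f i))) ∘ hypernorm L K A
     = fmap T (csum_map K (fun i => mu T (B i)))
       ∘ hypernorm L K (fun i => T (B i)) ∘ fmap T (csum_map K f)).
Proof.
split; [apply hypernorm_left_inverse|].
split; [apply hypernorm_idempotent|].
split; intros B f; [apply hypernorm_natural|].
now rewrite <- !comp_assoc, hypernorm_natural.
Qed.
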